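(* There exists an absolute constant $c>0$ such that for all integers $p\ge 1$ and $k\ge p$ there exist a graph $G=(V,E,\ell)$ of treewidth $p$ with nonnegative edge lengths and a set $R\subseteq V$ of $k$ terminals such that every distance-preserving minor $G'=(V',E',\ell')$ of $G$ with respect to $R$ has $|V'|\ge c\,kp$. In other words, $f^*(k,\mathrm{TW}(p))\ge c\,pk$, where $\mathrm{TW}(p)$ is the family of graphs of treewidth at most $p$.
   Context: $d_H$ denotes shortest-path distance in a graph $H$ with respect to its edge lengths. Given a graph $G=(V,E,\ell)$ and terminals $R\subseteq V$, a distance-preserving minor of $G$ with respect to $R$ is a graph $G'$ with edge lengths $\ell'$ (which may differ from $\ell$) such that $G'$ is a minor of $G$ in which the terminals survive (terminals are never deleted and no two terminals are merged; a terminal may be merged with non-terminals by contraction and the resulting vertex is identified with that terminal), so $R\subseteq V(G')$, and $d_{G'}(u,v)=d_G(u,v)$ for all $u,v\in R$. For a family $\mathcal{F}$ of graphs, $f^*(k,\mathcal{F})$ is the minimum number such that every graph in $\mathcal{F}$, with any nonnegative edge lengths and any $k$ terminals, admits a distance-preserving minor with at most $f^*(k,\mathcal{F})$ vertices. *)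

(* Defs.v *)
From HB Require Import structures.
From mathcomp Require Import all_boot all_order all_algebra.
From mathcomp Require Import boolp classical_sets reals ereal.

Set Implicit Arguments.
Unset Strict Implicit.
Unset Printing Implicit Defensive.

Import Order.TTheory GRing.Theory Num.Theory.

Local Open Scope ring_scope.

(* The vertex set is a subset of an ambient finite type T, so that a minor of
   a graph on T can again be a graph on T. *)
Record graph (T : finType) := Graph {
  vset :> {set T};
  edge : rel T;
  edge_sym : symmetric edge;
  edge_irr : irreflexive edge;
  edge_vset : forall x y, edge x y -> x \in vset
}.

Record wgraph (R : realType) (T : finType) := WGraph {
  ugraph :> graph T;
  len : T -> T -> R;
  len_sym : forall x y, len x y = len y x;
  len_ge0 : forall x y, edge ugraph x y -> 0 <= len x y
}.

Section Distance.
Variables (R : realType) (T : finType) (G : wgraph R T).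

(* The sequence x :: q lists the vertices of a simple path starting at x. *)
Definition path_length (x : T) (q : seq T) : R :=
  \sum_(r <- pairmap (len G) x q) r.

Definition simple_path (x y : T) (q : seq T) : Prop :=
  [/\ path (edge G) x q, last x q = y & uniq (x :: q)].

(* There are finitely many simple paths, so this infimum is a minimum, except
   that it is +oo when x and y are in different components. *)
Definition dist (x y : T) : \bar R :=
  ereal_inf [set ((path_length x q)%:E)%E | q in [set q | simple_path x y q]]%classic.

End Distance.

Section Minor.
Variables (T : finType) (K : {set T}).
Implicit Types G H : graph T.

Definition edge_deletion G H : Prop :=
  exists a b : T, [/\ edge G a b, vset H = vset G &
    forall x y, edge H x y = edge G x y && ([set x; y] != [set a; b])].

Definition vertex_deletion G H : Prop :=
  exists a : T, [/\ a \in vset G, a \notin K, vset H = vset G :\ a &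
    forall x y, edge H x y = [&& edge G x y, x != a & y != a]].

Definition merge (a b x : T) : T := if x == b then a else x.

(* Contraction of the edge ab; the new vertex is called a. As b is required not
   to be a terminal, two terminals are never merged, and a terminal merged with
   a nonterminal keeps its name. Loops and parallel edges are discarded. *)
Definition edge_contraction G H : Prop :=
  exists a b : T, [/\ edge G a b, b \notin K, vset H = vset G :\ b &
    forall x y, edge H x y =
      (x != y) && [exists x', exists y',
        [&& edge G x' y', merge a b x' == x & merge a b y' == y]]].

Inductive terminal_minor G : graph T -> Prop :=
| terminal_minor_refl : terminal_minor G G
| terminal_minor_step H H' :
    terminal_minor G H ->
    [\/ edge_deletion H H', vertex_deletion H H' | edge_contraction H H'] ->
    terminal_minor G H'.

End Minor.

Definition dist_preserving_minor (R : realType) (T : finType) (K : {set T})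
    (G G' : wgraph R T) : Prop :=
  terminal_minor K G G' /\
  (forall u v, u \in K -> v \in K -> dist G' u v = dist G u v).

Definition is_tree (I : finType) (t : rel I) : Prop :=
  [/\ (0 < #|I|)%N, symmetric t, irreflexive t,
      forall i j, connect t i j &
      forall c : seq I, (2 < size c)%N -> ~ ucycle t c].

Section Treewidth.
Variables (T : finType) (G : graph T).

Record tree_decomposition (I : finType) (t : rel I) (B : I -> {set T}) : Prop :=
  TreeDecomposition {
    td_tree : is_tree t;
    td_sub : forall i, B i \subset vset G;
    td_vertex : forall v, v \in vset G -> exists i, v \in B i;
    td_edge : forall u v, edge G u v -> exists i, (u \in B i) && (v \in B i);
    td_connected : forall v i j, v \in B i -> v \in B j ->
      connect [rel i' j' | [&& t i' j', v \in B i' & v \in B j']] i j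
  }.

Definition width (I : finType) (B : I -> {set T}) : nat :=
  (\max_(i : I) #|B i|).-1.

Definition has_decomposition (w : nat) : Prop :=
  exists (I : finType) (t : rel I) (B : I -> {set T}),
    tree_decomposition t B /\ width B = w.

Lemma has_decomposition_ex : exists w, `[< has_decomposition w >].
Proof.
exists (width (fun _ : unit => vset G)); apply/asboolP.
exists unit, (fun _ _ => false), (fun _ => vset G); split=> //; split.
- split=> //; first by rewrite card_unit.
  + by move=> [] [].
  + by move=> [|[] [|x c]] //= _ /andP[].
- by [].
- by move=> v Gv; exists tt.
- move=> u v uv; exists tt; rewrite (edge_vset uv) /=.
  by apply: (@edge_vset _ G v u); rewrite edge_sym.
- by move=> v [] [].
Qed.

(* The graph without vertices gets treewidth 0 (and not -1). *)
Definition treewidth : nat := ex_minn has_decomposition_ex.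

End Treewidth.

Definition graph_family := forall T : finType, graph T -> Prop.

Definition TW (p : nat) : graph_family :=
  fun T G => (treewidth G <= p)%N.

Definition minor_size_bound (R : realType) (k : nat) (F : graph_family)
    (N : nat) : Prop :=
  forall (T : finType) (G : wgraph R T) (K : {set T}),
    F T G -> K \subset vset G -> #|K| = k ->
    exists G' : wgraph R T,
      dist_preserving_minor K G G' /\ (#|vset G'| <= N)%N.

(* The least bound, or +oo if there is none. *)
Definition fstar (R : realType) (k : nat) (F : graph_family) : \bar R :=
  ereal_inf [set (N%:R%:E)%E | N in [set N | minor_size_bound R k F N]]%classic.

(* Main.v *)
Require Import Defs.
From mathcomp Require Import all_boot all_order all_algebra.
From mathcomp Require Import boolp classical_sets reals ereal.
From mathcomp Require Import zify lra.

Set Implicit Arguments.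
Unset Strict Implicit.
Unset Printing Implicit Defensive.

Import Order.TTheory GRing.Theory Num.Theory.

Local Open Scope ring_scope.

(* The hard graph is an (a+1) x (b+1) grid with unit lengths whose boundary
   consists of terminals; a disjoint clique and isolated vertices bring the
   treewidth to exactly p and the number of terminals to exactly k. In a
   distance-preserving minor, take for each row i a shortest path between its
   ends x_i and y_i. Two of these paths cannot meet, as exchanging their tails
   would give d(x_i, y_j) + d(x_j, y_i) <= d(x_i, y_i) + d(x_j, y_j), which fails
   in the grid. Hence the unions of branch sets along these paths are a+1
   disjoint connected sets, each joining the two ends of a row; as a column has
   only a+1 vertices, each set has exactly one vertex per column and contains
   its whole row. The same holds for columns. So the branch set of the grid
   vertex (i, j) is on the path of row i and on that of column j, and the
   (a+1)(b+1) grid vertices lie in different branch sets. *)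

(** * Walks, simple paths and distances *)

Section Distances.
Variables (R : realType) (T : finType) (G : wgraph R T).

Lemma path_length_cat x q1 q2 :
  path_length G x (q1 ++ q2) =
  path_length G x q1 + path_length G (last x q1) q2.
Proof. by rewrite /path_length pairmap_cat big_cat. Qed.

Lemma path_length_cons x y q :
  path_length G x (y :: q) = len G x y + path_length G y q.
Proof. by rewrite /path_length /= big_cons. Qed.

Lemma path_length_ge0 x q : path (edge G) x q -> 0 <= path_length G x q.
Proof.
elim: q x => [|y q IHq] x /=; first by rewrite /path_length big_nil.
by case/andP=> xy yq; rewrite path_length_cons addr_ge0 ?len_ge0 ?IHq.
Qed.

(** Edge lengths are nonnegative, so cutting a closed part out of the walk does not lengthen it. *)
Lemma simple_path_of_walk x q : path (edge G) x q ->
  exists2 q', simple_path G x (last x q) q' &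
    path_length G x q' <= path_length G x q.
Proof.
elim: q x => [|y q IHq] x /=; first by move=> _; exists [::].
case/andP=> xy /IHq [q' [yq' lastq' uq'] le_q'].
have [x_q'|x_q'] := boolP (x \in y :: q'); last first.
  exists (y :: q').
    by split; rewrite ?cons_uniq ?x_q' //= xy.
  by rewrite !path_length_cons lerD2l.
have xq : path_length G y q <= path_length G x (y :: q).
  by rewrite path_length_cons lerDr len_ge0.
move: x_q'; rewrite inE => /predU1P[xEy|x_q'].
  by subst y; exists q'; last exact: le_trans xq.
case/splitPr: x_q' => q1 q2 in yq' lastq' uq' le_q' *.
move: yq'; rewrite cat_path /= => /and3P[yq1 q1x xq2].
exists q2.
  split=> //; first by rewrite -lastq' last_cat.
  by move: uq'; rewrite -cat_cons cat_uniq => /and3P[].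
apply: le_trans xq; apply: le_trans le_q'.
rewrite path_length_cat path_length_cons addrA lerDr.
by rewrite addr_ge0 ?path_length_ge0 ?len_ge0.
Qed.

Lemma dist_le_walk x q : path (edge G) x q ->
  (dist G x (last x q) <= (path_length G x q)%:E)%E.
Proof.
move=> /simple_path_of_walk[q' q'P le_q'].
apply: (@le_trans _ _ (path_length G x q')%:E%E); last by rewrite lee_fin.
by apply: ereal_inf_lbound; exists q'.
Qed.

Lemma dist_ltP x y (r : R) : (dist G x y < r%:E)%E ->
  exists2 q, simple_path G x y q & path_length G x q < r.
Proof. by case/ereal_inf_lt => _ [q qP <-]; rewrite lte_fin; exists q. Qed.

Lemma le_dist x y (r : R) :
  (forall q, simple_path G x y q -> r <= path_length G x q) ->
  (r%:E <= dist G x y)%E.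
Proof.
by move=> rP; apply: le_ereal_inf_tmp => _ [q /rP rq <-]; rewrite lee_fin.
Qed.

(* Exchanging the tails of the two paths at a common vertex. *)
Lemma crossing_dist s t q s' t' q' v :
  simple_path G s t q -> simple_path G s' t' q' ->
  v \in s :: q -> v \in s' :: q' ->
  exists r r' : R, [/\ (dist G s t' <= r%:E)%E, (dist G s' t <= r'%:E)%E &
    r + r' = path_length G s q + path_length G s' q'].
Proof.
move=> [sq <- _] [sq' <- _] vq vq'.
case/splitPl: vq sq => q1 q2 lastq1; case/splitPl: vq' sq' => q1' q2' lastq1'.
rewrite !cat_path lastq1 lastq1' => /andP[sq1' vq2'] /andP[sq1 vq2].
exists (path_length G s (q1 ++ q2')), (path_length G s' (q1' ++ q2)).
rewrite !path_length_cat !last_cat lastq1 lastq1'.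
have := @dist_le_walk s (q1 ++ q2').
have := @dist_le_walk s' (q1' ++ q2).
rewrite !cat_path !last_cat !path_length_cat lastq1 lastq1' sq1 sq1' vq2 vq2'.
by move=> /(_ isT) d1 /(_ isT) d2; split=> //; lra.
Qed.

End Distances.

(** * Branch sets of minors, and connectivity *)

Section MinorModel.
Variables (T : finType) (K : {set T}).

(* Each vertex of G is sent to the vertex of H into whose branch set it was
   contracted, or to a deleted vertex. *)
Record minor_model (G H : graph T) (f : T -> T) : Prop := MinorModel {
  model_id : forall v, v \in vset H -> f v = v;
  model_connect :
    forall x, connect [rel y z | edge G y z && (f y == f z)] x (f x);
  model_edge : forall u v, edge H u v ->
    exists x y, [/\ edge G x y, f x = u & f y = v]
}.

(** Induction on the operations: deletions leave [f] unchanged, and contracting [ab] composes it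
    with [merge a b]. No operation removes a vertex of [K]. *)
Lemma terminal_minor_model (G H : graph T) : terminal_minor K G H ->
  K \subset vset G -> K \subset vset H /\ exists f, minor_model G H f.
Proof.
move=> minorH KG; elim: H / minorH => [|H H' _ [KH [f [fid fconn fedge]]]].
  by split=> //; exists id; split=> // u v uv; exists u, v.
case=> [[a [b [_ vH' eH']]]|[a [_ aK vH' eH']]|[a [b [ab bK vH' eH']]]].
- split; first by rewrite vH'.
  exists f; split=> // [v|u v]; first by rewrite vH'; apply: fid.
  by rewrite eH' => /andP[/fedge].
- split; first by rewrite vH' subsetD1 KH.
  exists f; split=> // [v|u v]; first by rewrite vH' => /setD1P[_ /fid].
  by rewrite eH' => /and3P[/fedge].
- split; first by rewrite vH' subsetD1 KH.
  have sub : subrel (connect [rel y z | edge G y z && (f y == f z)])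
      (connect [rel y z | edge G y z &&
        (Defs.merge a b (f y) == Defs.merge a b (f z))]).
    apply: connect_sub => y z /= /andP[yz /eqP fyz].
    by apply: connect1; rewrite /= yz fyz eqxx.
  exists (Defs.merge a b \o f); split.
  + move=> v; rewrite vH' => /setD1P[vb /fid fv] /=.
    by rewrite /Defs.merge fv (negPf vb).
  + move=> x /=; apply: connect_trans (sub _ _ (fconn x)) _.
    have [->|fxb] := eqVneq (f x) b; last first.
      by rewrite [Defs.merge a b (f x)]/Defs.merge (negPf fxb).
    have -> : Defs.merge a b b = a by rewrite /Defs.merge eqxx.
    (* A lift [x'y'] of the contracted edge joins the two old branch sets: the path runs through
       [a], [x'], [y'], [b]. *)
    have [x' [y' [x'y' fx' fy']]] := fedge _ _ ab.
    have symG : connect_sym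
        [rel y z | edge G y z && (Defs.merge a b (f y) == Defs.merge a b (f z))].
      by apply: sym_connect_sym => y z /=; rewrite edge_sym eq_sym.
    rewrite symG; apply: (@connect_trans _ _ x').
      by rewrite symG; have := sub _ _ (fconn x'); rewrite fx'.
    apply: (@connect_trans _ _ y'); last first.
      by have := sub _ _ (fconn y'); rewrite fy'.
    apply: connect1; rewrite /= x'y' fx' fy' /Defs.merge eqxx.
    by case: (a == b); rewrite eqxx.
  + move=> u v; rewrite eH' => /andP[_ /existsP[u' /existsP[v']]].
    move=> /and3P[/fedge[x [y [xy <- <-]]] /eqP <- /eqP <-].
    by exists x, y.
Qed.

Definition inside (G : graph T) (f : T -> T) (P : {set T}) : rel T :=
  [rel x y | [&& edge G x y, f x \in P & f y \in P]].

(** The path lifts to [G]: move within a branch set to the end of a lifted edge, cross it, and go on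
    in the next branch set. *)
Lemma model_path (G H : graph T) f x q (P : {set T}) :
  minor_model G H f -> path (edge H) x q -> x \in vset H ->
  {subset x :: q <= P} -> connect (inside G f P) x (last x q).
Proof.
move=> [fid fconn fedge].
have sym : connect_sym (inside G f P).
  apply: sym_connect_sym => y z /=.
  by rewrite /inside /= edge_sym [(f y \in P) && _]andbC.
(* [f] is constant along a path within a branch set, so the whole path stays inside [P]. *)
have fibre y : f y \in P -> connect (inside G f P) y (f y).
  move=> yP; case/connectP: (fconn y) => r yr ->.
  elim: r y yP yr => [|z r IHr] y yP /=; first by move=> *; apply: connect0.
  move=> /andP[/andP[yz /eqP fyz] zr].
  apply: (@connect_trans _ _ z); last by apply: IHr; rewrite // -fyz.
  by apply: connect1; rewrite /inside /= yz -fyz yP.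
elim: q x => [|y q IHq] x /=; first by move=> *; apply: connect0.
case/andP=> xy yq xH subP.
have yH : y \in vset H by apply: (@edge_vset _ H y x); rewrite edge_sym.
have [xP yP] : x \in P /\ y \in P by rewrite !subP ?inE ?eqxx ?orbT.
apply: connect_trans (IHq _ yq yH _); last first.
  by move=> z zq; apply: subP; rewrite inE zq orbT.
have [x' [y' [x'y' fx' fy']]] := fedge _ _ xy.
apply: (@connect_trans _ _ x').
  by rewrite sym; have := fibre x'; rewrite fx'; apply.
apply: (@connect_trans _ _ y'); last first.
  by have := fibre y'; rewrite fy'; apply.
by apply: connect1; rewrite /inside /= x'y' fx' fy' xP.
Qed.

End MinorModel.

(** Invariance is asked only for steps from vertices reachable from [x], so reachability may be used
    along with the invariant. *)
Lemma connect_invariant (T : finType) (e : rel T) (P : T -> Prop) x y :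
  connect e x y -> P x -> (forall u v, connect e x u -> e u v -> P u -> P v) ->
  P y.
Proof.
move=> /connectP[q + ->] Px step.
elim/last_ind: q => [|q z IHq]; first by [].
rewrite rcons_path last_rcons => /andP[xq qz].
by apply: step qz (IHq xq); apply/connectP; exists q.
Qed.

(** * Grids: distances and rigidity *)

Definition consecutive (m n : nat) := (m.+1 == n) || (n.+1 == m).

(** The equivalence ranges over all [z], so no edge leaves the grid and a walk from a grid vertex
    stays in it. *)
Definition embedded_grid (T : finType) (G : graph T) a b
    (g : 'I_a.+1 -> 'I_b.+1 -> T) :=
  (forall i j i' j', g i j = g i' j' -> i = i' /\ j = j') /\
  (forall i j z, edge G (g i j) z <-> exists i' j', z = g i' j' /\
    (i = i' /\ consecutive j j' \/ j = j' /\ consecutive i i')).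

Lemma embedded_grid_tr (T : finType) (G : graph T) a b
    (g : 'I_a.+1 -> 'I_b.+1 -> T) :
  embedded_grid G g -> embedded_grid G (fun j i => g i j).
Proof.
case=> g_inj gE; split=> [j i j' i' /g_inj[] //|j i z]; rewrite gE.
by split=> -[i' [j' [-> [] ij]]]; exists j', i'; split=> //; by [left|right].
Qed.

Section Grid.
Variables (R : realType) (T : finType) (G : wgraph R T) (a b : nat).
Variable g : 'I_a.+1 -> 'I_b.+1 -> T.
Hypothesis g_grid : embedded_grid G g.
Hypothesis unit_len : forall x y, len G x y = 1.

Lemma path_length_unit x q : path_length G x q = (size q)%:R.
Proof.
elim: q x => [|y q IHq] x; first by rewrite /path_length big_nil.
by rewrite path_length_cons IHq unit_len -natr1 addrC.
Qed.

(** Each edge changes one coordinate by one. Subtraction is truncated, so [(i - i') + (i' - i)] is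
    the absolute difference of the rows. *)
Lemma grid_walk_size i j i' j' q : path (edge G) (g i j) q ->
  last (g i j) q = g i' j' -> (j' + (i - i') + (i' - i) <= j + size q)%N.
Proof.
have [g_inj gE] := g_grid.
elim: q i j => [|y q IHq] i j /=; first by move=> _ /g_inj[-> ->]; lia.
case/andP=> /gE[i1 [j1 [-> ij]]] /IHq q_le /q_le {q_le}.
by case: ij => -[->]; rewrite /consecutive => ? ?; lia.
Qed.

Lemma grid_row_walk i n : (n <= b)%N -> exists q,
  [/\ path (edge G) (g i ord0) q, last (g i ord0) q = g i (inord n)
    & size q = n].
Proof.
have [g_inj gE] := g_grid.
elim: n => [|n IHn] le_n.
  by exists [::]; split=> //=; congr (g i); apply: val_inj; rewrite /= inordK.
have [q [iq lastq sizeq]] := IHn (ltnW le_n).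
exists (rcons q (g i (inord n.+1))).
split; rewrite ?last_rcons ?size_rcons ?sizeq // rcons_path iq lastq /=.
apply/gE; exists i, (inord n.+1); split=> //; left; split=> //.
by rewrite /consecutive !inordK ?eqxx //; lia.
Qed.

Lemma grid_row_dist i : (dist G (g i ord0) (g i ord_max) <= b%:R%:E)%E.
Proof.
have [q [iq lastq sizeq]] := @grid_row_walk i b (leqnn b).
have -> : ord_max = inord b :> 'I_b.+1 by apply: val_inj; rewrite /= inordK.
by have := dist_le_walk iq; rewrite path_length_unit lastq sizeq.
Qed.

Lemma grid_cross_dist i i' : i != i' ->
  (b.+1%:R%:E <= dist G (g i ord0) (g i' ord_max))%E.
Proof.
move=> ii'; apply: le_dist => q [iq lastq _].
rewrite path_length_unit ler_nat; have := grid_walk_size iq lastq.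
have : nat_of_ord i <> i' by move/val_inj/eqP; apply/negP.
by rewrite /=; lia.
Qed.

(* There are as many disjoint sets as vertices in a column, so each set has
   exactly one vertex per column and can only move horizontally. *)
Lemma grid_rigid (f : T -> T) (P : 'I_a.+1 -> {set T}) :
  (forall i i' x, x \in P i -> x \in P i' -> i = i') ->
  (forall i, connect (inside G f (P i)) (g i ord0) (g i ord_max)) ->
  (forall i, f (g i ord0) \in P i) ->
  forall i j, f (g i j) \in P i.
Proof.
move=> disjP connP P0; have [g_inj gE] := g_grid.
(* Discrete intermediate values: an edge changes the column by at most one, so a path that missed
   column [j] would stay to its left. *)
have column i j : exists r,
    connect (inside G f (P i)) (g i ord0) (g r j) /\ f (g r j) \in P i.
  have [->|j0] := eqVneq j ord0; first by exists i; rewrite connect0 P0.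
  apply: contrapT => no_r.
  suff [i' [j' [/g_inj[_ <-] /=]]] :
      exists i' (j' : 'I_b.+1), g i ord_max = g i' j' /\ (j' < j)%N.
    by have := ltn_ord j; lia.
  apply: (connect_invariant (connP i)
    (P := fun z => exists i' (j' : 'I_b.+1), z = g i' j' /\ (j' < j)%N)).
    exists i, ord0; split=> //=; rewrite lt0n.
    by apply: contra j0 => /eqP j0; apply/eqP/val_inj.
  move=> u v iu uv [i' [j' [uE j'j]]].
  have iv := connect_trans iu (connect1 uv).
  move: uv; rewrite uE => /and3P[/gE[i1 [j1 [vE ij]]] _ vP].
  exists i1, j1; split=> //.
  have : nat_of_ord j1 <> j.
    by move/val_inj=> j1E; apply: no_r; exists i1; rewrite -j1E -vE.
  by case: ij => -[ij]; rewrite /consecutive -?ij; lia.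
pose r j i := projT1 (cid (column i j)).
have rP j i : connect (inside G f (P i)) (g i ord0) (g (r j i) j) /\
    f (g (r j i) j) \in P i by rewrite /r; case: cid.
have r_inj j : injective (r j).
  move=> i i' rE; apply: (disjP i i' (f (g (r j i) j))).
    by have [] := rP j i.
  by rewrite rE; have [] := rP j i'.
(* An injective [r j] is onto, so each vertex of column [j] is the chosen one of some set, and by
   disjointness of no other. *)
have one_per_column i j s : f (g s j) \in P i -> s = r j i.
  have /codomP[i' ->] : s \in codom (r j) by rewrite inj_card_onto.
  by have [_ +] := rP j i' => /disjP /[apply] <-.
(* A vertical edge inside [P i] would give [P i] two vertices of one column. *)
have row i z : connect (inside G f (P i)) (g i ord0) z -> exists j, z = g i j.
  move=> iz; apply: (connect_invariant iz
    (P := fun z => exists j, z = g i j)); first by exists ord0.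
  move=> u v _ /and3P[uv uP vP] [j uE]; subst u.
  move/gE: uv => [i1 [j1 [vE ij]]]; subst v.
  case: ij => -[ij ii1]; first by exists j1; rewrite ij.
  subst j1; move/one_per_column: uP => iE; move/one_per_column: vP => i1E.
  by move: ii1; rewrite iE i1E /consecutive; lia.
move=> i j; have [/row[j' /g_inj[rE _]]] := rP j i.
by rewrite rE.
Qed.

Lemma grid_minor_rows (K : {set T}) (G' : wgraph R T) (f : T -> T) :
  minor_model G G' f -> K \subset vset G' ->
  (forall i, g i ord0 \in K) -> (forall i, g i ord_max \in K) ->
  (forall u v, u \in K -> v \in K -> dist G' u v = dist G u v) ->
  exists P : 'I_a.+1 -> {set T},
    (forall i i' x, x \in P i -> x \in P i' -> i = i') /\
    (forall i j, f (g i j) \in P i /\ f (g i j) \in vset G').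
Proof.
move=> fP KG' K0 Kmax distE.
(* The slack [2^-1] avoids showing that the infimum is attained: two such paths have total length
   below [2b + 1], while exchanged tails would need at least [2b + 2]. *)
have qP i : exists q, simple_path G' (g i ord0) (g i ord_max) q /\
    path_length G' (g i ord0) q < b%:R + 2^-1.
  have : (dist G' (g i ord0) (g i ord_max) < (b%:R + 2^-1)%:E)%E.
    rewrite distE //; apply: le_lt_trans (grid_row_dist i) _.
    by rewrite lte_fin; lra.
  by case/dist_ltP => q; exists q.
pose q i := projT1 (cid (qP i)).
have qE i : simple_path G' (g i ord0) (g i ord_max) (q i) /\
  path_length G' (g i ord0) (q i) < b%:R + 2^-1 by rewrite /q; case: cid.
pose P i := [set x in g i ord0 :: q i].
have cross i i' (r : R) : i != i' ->
    (dist G' (g i ord0) (g i' ord_max) <= r%:E)%E -> b%:R + 1 <= r.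
  rewrite distE // natr1 -lee_fin => ii'.
  exact: le_trans (grid_cross_dist ii').
have disjP i i' x : x \in P i -> x \in P i' -> i = i'.
  rewrite !inE => xi xi'; apply/eqP; apply: contraT => ii'.
  have [qi leni] := qE i; have [qi' leni'] := qE i'.
  have [] := crossing_dist qi qi' (v := x); rewrite ?inE //.
  move=> r [r' [le_r le_r' sumE]].
  have := cross _ _ _ ii' le_r.
  by have := cross i' i _ _ le_r'; rewrite eq_sym ii' => /(_ isT); lra.
have K0' i : g i ord0 \in vset G' by apply: (fintype.subsetP KG').
have rows : forall i j, f (g i j) \in P i.
  apply: grid_rigid => // i; last by rewrite (model_id fP) // !inE eqxx.
  have [[iq <- _] _] := qE i.
  by apply: model_path fP iq _ _ => // x xq; rewrite inE.
exists P; split=> // i j; split; first exact: rows.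
have [[iq _ _] _] := qE i.
have /(_ (f (g i j))) : {subset g i ord0 :: q i <= vset G'}; last first.
  by apply; have := rows i j; rewrite inE.
move: iq; elim: (q i) (g i ord0) (K0' i) => [|y s IHs] x xG' /=.
  by move=> _ z; rewrite inE => /eqP->.
case/andP=> xy ys z; rewrite inE => /predU1P[-> //|]; apply: IHs => //.
by apply: (@edge_vset _ G' y x); rewrite edge_sym.
Qed.

End Grid.

Lemma grid_minor_size (R : realType) (T : finType) (G : wgraph R T) a b
    (g : 'I_a.+1 -> 'I_b.+1 -> T) (K : {set T}) (G' : wgraph R T) :
  embedded_grid G g -> (forall x y, len G x y = 1) -> K \subset vset G ->
  (forall i, g i ord0 \in K) -> (forall i, g i ord_max \in K) ->
  (forall j, g ord0 j \in K) -> (forall j, g ord_max j \in K) ->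
  dist_preserving_minor K G G' -> (a.+1 * b.+1 <= #|vset G'|)%N.
Proof.
move=> g_grid unit_len KG Kl Kr Kt Kb [/terminal_minor_model/(_ KG)].
move=> [KG' [f fP]] distE.
have [P [disjP PP]] := grid_minor_rows g_grid unit_len fP KG' Kl Kr distE.
have [Q [disjQ QP]] :=
  grid_minor_rows (embedded_grid_tr g_grid) unit_len fP KG' Kt Kb distE.
(* The sets [P] recover the row from a branch set, and the sets [Q] the column. *)
pose h (ij : 'I_a.+1 * 'I_b.+1) := f (g ij.1 ij.2).
have h_inj : injective h.
  move=> [i j] [i' j']; rewrite /h /= => fE; congr pair.
    by apply: (disjP _ _ (f (g i j))); [|rewrite fE]; apply: (PP _ _).1.
  by apply: (disjQ _ _ (f (g i j))); [|rewrite fE]; apply: (QP _ _).1.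
rewrite -[a.+1]card_ord -[b.+1]card_ord -card_prod -(card_imset _ h_inj).
apply/subset_leq_card/fintype.subsetP => _ /imsetP[[i j] _ ->].
exact: (PP i j).2.
Qed.

(** * Treewidth from below, by cliques *)

Lemma tree_bridge (I : finType) (t : rel I) i j : is_tree t -> t i j ->
  ~~ connect [rel x y | t x y && ([set x; y] != [set i; j])] i j.
Proof.
case=> _ t_sym t_irr _ acyclic tij; apply/negP => /connectP[q iq jE].
case/shortenP: iq jE => q' iq' uq' _ jE.
have tq' : path t i q' by apply: sub_path iq' => x y /= /andP[].
(* Together with [ij] the path closes a cycle; it has at least two edges, as [ij] itself is
   excluded. *)
apply: (acyclic (i :: q')); last first.
  by rewrite /ucycle /cycle rcons_path tq' -jE t_sym tij.
case: q' iq' jE {uq' tq'} => [|x [|y q']] //=.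
  by move=> _ ji; rewrite ji t_irr in tij.
by move=> + jE; rewrite jE eqxx andbF.
Qed.

(** The iterates of [x] run into an earlier one, which therefore lies on a cycle of [phi]. *)
Lemma periodic_point (I : finType) (phi : I -> I) (x : I) :
  exists y, iter (order phi y) phi y = y.
Proof.
have /trajectP[m m_lt mE] := looping_order phi x.
exists (iter m phi x); apply/(orbitPcycle 3 4).
exists (order phi x - m).-1; rewrite prednK ?subn_gt0 // -iterD subnK //.
exact: ltnW.
Qed.

Section Treewidth.
Variables (T : finType) (G : graph T).

(* If every bag i missed some vertex of the clique, let phi i be the
   neighbour of i towards the bags of that vertex. As the tree has no cycle,
   some edge ij has phi i = j and phi j = i, and it separates the bags of two
   vertices of the clique. *)
Lemma clique_in_bag (I : finType) (t : rel I) (B : I -> {set T}) (C : {set T}) :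
  tree_decomposition G t B -> C \subset vset G ->
  {in C &, forall u v, u != v -> edge G u v} -> exists i, C \subset B i.
Proof.
move=> [treeP _ vertexP edgeP connP] CG CE; apply: contrapT => no_bag.
have [I0 t_sym t_irr t_conn acyclic] := treeP.
pose away i := [rel x y | [&& t x y, x != i & y != i]].
have phiP i : exists j, t i j /\ exists v, [/\ v \in C &
    forall m, v \in B m -> connect (away i) j m].
  have /subsetPn[v vC vBi] : ~~ (C \subset B i).
    by apply/negP => CBi; apply: no_bag; exists i.
  have [k vBk] := vertexP v (fintype.subsetP CG v vC).
  have /connectP[q iq kE] := t_conn i k.
  case/shortenP: iq kE => -[|j q'] /= iq' uq' _ kE.
    by rewrite -kE vBk in vBi.
  move: iq' uq' => /andP[tij jq'] /and3P[iq' _ _].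
  exists j; split=> //; exists v; split=> // m vBm.
  apply: (@connect_trans _ _ k).
    apply/connectP; exists q' => //.
    elim: q' j jq' iq' {kE tij} => [|z q' IHq] j //= /andP[tjz zq'].
    rewrite !inE !negb_or => /and3P[ij iz iq'].
    by rewrite tjz eq_sym ij eq_sym iz IHq // inE negb_or iz.
  (* The bags of [v] are connected to each other without [i], whose bag misses [v]. *)
  apply: connect_sub (connP v k m vBk vBm) => x y /= /and3P[txy vx vy].
  apply: connect1; rewrite /= txy /=.
  by apply/andP; split; apply: contraNneq vBi => <-.
pose phi i := projT1 (cid (phiP i)).
have phiE i : t i (phi i) /\ exists v, [/\ v \in C &
    forall m, v \in B m -> connect (away i) (phi i) m].
  by rewrite /phi; case: cid.
have [x0 _] := card_gt0P I0.
have [i iE] := periodic_point phi x0.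
(* An orbit of three or more points would be a cycle of the tree, and [t] has no loops, so the
   period is exactly 2. *)
have order_le2 : (order phi i <= 2)%N.
  rewrite leqNgt -size_orbit; apply/negP => /acyclic; apply.
  rewrite /ucycle orbit_uniq andbT.
  move/(orbitPcycle 4 0): (iE); apply: sub_cycle => x y /eqP <-.
  by have [] := phiE x.
have phi2 : phi (phi i) = i.
  case: (order phi i) (order_gt0 phi i) order_le2 iE => [|[|[|]]] //= _ _ iE.
  by have [] := phiE i; rewrite iE t_irr.
have [tij [u [uC uP]]] := phiE i.
have [_ [w [wC]]] := phiE (phi i); rewrite phi2 => wP.
(* The common bag [m] is reached from [phi i] avoiding [i] and from [i] avoiding [phi i], which
   links both ends without the edge between them. *)
have [m /andP[um wm]] : exists m, (u \in B m) && (w \in B m).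
  have [<-|uw] := eqVneq u w; last exact: edgeP (CE _ _ _ _ uw).
  by have [m um] := vertexP u (fintype.subsetP CG u uC); exists m; rewrite um.
have /negP[] := tree_bridge treeP tij.
set e := (X in connect X).
have e_sym : connect_sym e.
  by apply: sym_connect_sym => x y /=; rewrite /e /= t_sym finset.setUC.
apply: (@connect_trans _ _ m).
  apply: connect_sub (wP m wm) => x y /and3P[txy xj yj].
  apply: connect1; rewrite /e /= txy /=; apply: contra xj => /eqP xyE.
  have := set22 i (phi i); rewrite -xyE !inE => /orP[/eqP-> //|/eqP yE].
  by rewrite -yE eqxx in yj.
rewrite e_sym.
apply: connect_sub (uP m um) => x y /and3P[txy xi yi].
apply: connect1; rewrite /e /= txy /=; apply: contra xi => /eqP xyE.
have := set21 i (phi i); rewrite -xyE !inE => /orP[/eqP-> //|/eqP yE].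
by rewrite -yE eqxx in yi.
Qed.

Lemma treewidth_ge_clique (C : {set T}) : C \subset vset G ->
  {in C &, forall u v, u != v -> edge G u v} -> (#|C|.-1 <= treewidth G)%N.
Proof.
move=> CG CE; rewrite /treewidth.
case: ex_minnP => _ /asboolP[I [t [B [tdB <-]]]] _.
have [i CB] := clique_in_bag tdB CG CE.
rewrite /width -!subn1 leq_sub2r //.
by apply: leq_trans (subset_leq_card CB) _; apply: leq_bigmax.
Qed.

(** * Treewidth from above, by bandwidth *)

Definition line n : rel 'I_n.+1 := fun i j => consecutive i j.
Arguments line : clear implicits.

Lemma line_connect n (S : pred 'I_n.+1) (i j : 'I_n.+1) :
  (forall k : 'I_n.+1, i <= k <= j -> S k)%N -> (i <= j)%N ->
  connect [rel x y | [&& line n x y, S x & S y]] i j.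
Proof.
move=> ijS ij; move: {2}(j - i)%N (erefl (j - i)%N) => d dE.
elim: d j dE ij ijS => [|d IHd] j dE ij ijS.
  have -> : i = j by apply: val_inj => /=; lia.
  exact: connect0.
have j_gt : (j.-1 < n.+1)%N by have := ltn_ord j; lia.
apply: (@connect_trans _ _ (Ordinal j_gt)).
  apply: IHd => /=; [lia|lia|move=> k ik; apply: ijS; lia].
by apply: connect1; rewrite /= !ijS /line /consecutive /=; lia.
Qed.

(** For acyclicity: the two neighbours of the largest vertex [m] of a cycle are distinct, yet both
    must be [m - 1]. *)
Lemma line_tree n : is_tree (line n).
Proof.
have line_sym : symmetric (line n).
  by move=> i j; rewrite /line /consecutive /= orbC.
have lineC : connect_sym (line n) by apply: sym_connect_sym.
split=> //; first by rewrite card_ord.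
- by move=> i; rewrite /line /consecutive /=; lia.
- have le_conn (i j : 'I_n.+1) : (i <= j)%N -> connect (line n) i j.
    move=> ij; have := @line_connect n predT i j (fun _ _ => isT) ij.
    by apply: connect_sub => x y /and3P[xy _ _]; apply: connect1.
  move=> i j; case: (leqP i j) => [|/ltnW] ij; first exact: le_conn.
  by rewrite lineC le_conn.
move=> c c_gt /andP[cyc uc].
have [x0 x0c] : exists x0, x0 \in c.
  by case: c c_gt {cyc uc} => // x c _; exists x; rewrite mem_head.
have [m mc max_m] := @arg_maxnP _ x0 (mem c) val x0c.
have [k s cE] := rot_to mc.
have us : uniq (m :: s) by rewrite -cE rot_uniq.
have cycs : cycle (line n) (m :: s) by rewrite -cE rot_cycle.
have s_le x : x \in s -> (x <= m)%N.
  by move=> xs; apply: (max_m x); rewrite /= -(mem_rot k) cE inE xs orbT.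
have ss : (1 < size s)%N by move: c_gt; rewrite -(size_rot k) cE.
case: s us cycs s_le ss {cE} => [|x s] //= /and3P[_ xs _].
rewrite rcons_path => /and3P[mx _ ym] s_le s_gt.
have ys : last x s \in s.
  by case: s s_gt {xs ym s_le mx} => //= z s _; apply: mem_last.
suff xE : x = last x s by rewrite {1}xE ys in xs.
have := s_le x (mem_head _ _); have := s_le (last x s) _.
rewrite inE ys orbT => /(_ isT); move: mx ym; rewrite /line /consecutive.
move: (last x s) => y *; apply: ord_inj; lia.
Qed.

(** The bags are windows of [p.+1] consecutive positions, arranged along a path. The window starting
    at the earlier end of an edge contains the other end too. *)
Lemma treewidth_le_bandwidth (p : nat) (pos : T -> nat) : injective pos ->
  (forall u v, edge G u v -> pos u <= pos v + p)%N -> (treewidth G <= p)%N.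
Proof.
move=> pos_inj edge_pos; rewrite /treewidth.
case: ex_minnP => w _ w_min.
pose n := \max_v pos v.
have pos_le v : (pos v < n.+1)%N by rewrite ltnS; apply: leq_bigmax.
pose B (i : 'I_n.+1) := [set v in vset G | i <= pos v <= i + p]%N.
apply: (@leq_trans (width B)).
  apply: w_min; apply/asboolP; exists 'I_n.+1, (line n), B; split=> //; split.
  - exact: line_tree.
  - by move=> i; apply/fintype.subsetP => v; rewrite inE => /andP[].
  - move=> v vG; exists (Ordinal (pos_le v)).
    by rewrite inE vG /=; lia.
  - move=> u v uv.
    have vu : edge G v u by rewrite edge_sym.
    have [uG vG] := (edge_vset uv, edge_vset vu).
    have [uv_le vu_le] := (edge_pos _ _ uv, edge_pos _ _ vu).
    case: (leqP (pos u) (pos v)) => le_uv.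
      by exists (Ordinal (pos_le u)); rewrite !inE uG vG /=; lia.
    by exists (Ordinal (pos_le v)); rewrite !inE uG vG /=; lia.
  - move=> v.
    have le_conn (i j : 'I_n.+1) : (i <= j)%N -> v \in B i -> v \in B j ->
        connect [rel x y | [&& line n x y, v \in B x & v \in B y]] i j.
      move=> ij; rewrite !inE => /andP[vG vi] /andP[_ vj].
      apply: (line_connect (S := fun x => v \in B x)) => // k ikj.
      by rewrite inE vG; lia.
    move=> i j vi vj; case: (leqP i j) => [|/ltnW] ij; first exact: le_conn.
    rewrite sym_connect_sym; first exact: le_conn.
    by move=> x y; rewrite /= /line /consecutive orbC [(v \in B x) && _]andbC.
rewrite /width -[p]/(p.+1.-1) -!subn1 leq_sub2r //.
apply/bigmax_leqP => i _.
have f_inj : {in B i &, injective (fun v => inord (pos v - i) : 'I_p.+1)}.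
  move=> u v; rewrite !inE => /andP[_ ui] /andP[_ vi] /(congr1 val) /=.
  rewrite !inordK; try lia.
  by move=> uv; apply: pos_inj; lia.
by rewrite -(card_in_imset f_inj) (leq_trans (max_card _)) ?card_ord.
Qed.

End Treewidth.

(** * The hard graph and its terminals *)

Section HardGraph.
Variables (R : realType) (a b p k : nat).

Let T : finType := (('I_a.+1 * 'I_b.+1) + 'I_k.+1)%type.

Definition hard_edge : rel T := fun u v =>
  match u, v with
  | inl (i, j), inl (i', j') =>
      ((i == i') && consecutive j j') || ((j == j') && consecutive i i')
  | inr x, inr y => [&& x != y, x <= p & y <= p]%N
  | _, _ => false
  end.

Lemma hard_edge_sym : symmetric hard_edge.
Proof.
move=> [[i j]|x] [[i' j']|y] //=; last by rewrite eq_sym [(x <= p)%N && _]andbC.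
rewrite [i == i']eq_sym [j == j']eq_sym.
by congr (_ && _ || _ && _); apply: orbC.
Qed.

Lemma hard_edge_irr : irreflexive hard_edge.
Proof. by move=> [[i j]|x] /=; rewrite /consecutive ?eqxx //; lia. Qed.

Lemma hard_edge_vset x y : hard_edge x y -> x \in [set: T].
Proof. by rewrite inE. Qed.

Definition hard_graph : graph T :=
  Graph hard_edge_sym hard_edge_irr hard_edge_vset.

Lemma hard_len_ge0 x y : edge hard_graph x y -> 0 <= 1 :> R.
Proof. by rewrite ler01. Qed.

Definition hard_wgraph : wgraph R T :=
  WGraph (len := fun _ _ => 1) (fun _ _ => erefl) hard_len_ge0.

Definition hard_grid (i : 'I_a.+1) (j : 'I_b.+1) : T := inl (i, j).

Lemma hard_grid_embedded : embedded_grid hard_wgraph hard_grid.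
Proof.
split=> [i j i' j' []//|i j [[i' j']|x]] /=; last by split=> [|[? [? []]]].
split=> [/orP[|] /andP[/eqP ij ij']|[_ [_ [[<- <-]]]]].
- by exists i', j'; split=> //; left.
- by exists i', j'; split=> //; right.
by case=> -[-> ->]; rewrite eqxx ?orbT.
Qed.

(** Numbering the grid column by column, a grid edge spans at most [a.+1] positions, hence at most
    [p] when [a < p]; a clique edge spans at most [p] as well. *)
Definition hard_pos (u : T) : nat :=
  match u with
  | inl (i, j) => j * a.+1 + i
  | inr x => a.+1 * b.+1 + x
  end.

Lemma hard_treewidth : (a < p)%N -> (p <= k)%N -> treewidth hard_graph = p.
Proof.
move=> ap pk; apply/eqP; rewrite eqn_leq; apply/andP; split.
  apply: (treewidth_le_bandwidth (pos := hard_pos)).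
    have pos_lt (i : 'I_a.+1) (j : 'I_b.+1) : (j * a.+1 + i < a.+1 * b.+1)%N.
      have := ltn_ord i; have := ltn_ord j; nia.
    move=> [[i j]|x] [[i' j']|y] /=.
    - move=> e.
      have ei : i = i' :> nat.
        by have := congr1 (modn^~ a.+1) e; rewrite !modnMDl !modn_small.
      have ej : j = j' :> nat.
        by move: e; rewrite ei => /addIn /eqP; rewrite eqn_pmul2r // => /eqP.
      by rewrite (val_inj ei) (val_inj ej).
    - by have := pos_lt i j; lia.
    - by have := pos_lt i' j'; lia.
    - by move/addnI/val_inj->.
  move=> [[i j]|x] [[i' j']|y] //=; last by lia.
  case/orP=> /andP[/eqP-> ]; rewrite /consecutive; last by lia.
  by case/orP => /eqP <-; rewrite mulSn; lia.
pose C := [set (inr (inord i) : T) | i : 'I_p.+1].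
have <- : #|C|.-1 = p.
  rewrite card_imset ?card_ord // => i j [] /(congr1 val) /=.
  have := ltn_ord i; have := ltn_ord j => ? ?.
  by rewrite !inordK; [apply: val_inj|lia|lia].
apply: treewidth_ge_clique; first exact: finset.subsetT.
move=> _ _ /imsetP[i _ ->] /imsetP[j _ ->] ij /=.
have := ltn_ord i; have := ltn_ord j => ? ?.
rewrite !inordK; [|lia|lia].
apply/and3P; split; [|lia|lia].
by apply: contra ij => /eqP ->.
Qed.

Definition hard_boundary : {set T} :=
  [set hard_grid ij.1 ij.2 | ij in [set ij : 'I_a.+1 * 'I_b.+1 |
    [|| ij.1 == ord0, ij.1 == ord_max, ij.2 == ord0 | ij.2 == ord_max]]].

Lemma card_hard_boundary : (#|hard_boundary| <= 2 * a.+1 + 2 * b.+1)%N.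
Proof.
pose side (s : ('I_a.+1 + 'I_a.+1) + ('I_b.+1 + 'I_b.+1)) : T :=
  match s with
  | inl (inl i) => hard_grid i ord0
  | inl (inr i) => hard_grid i ord_max
  | inr (inl j) => hard_grid ord0 j
  | inr (inr j) => hard_grid ord_max j
  end.
have sub : hard_boundary \subset [set side s | s in predT].
  apply/fintype.subsetP => u /imsetP[[i j]]; rewrite inE /= => ij ->.
  apply/imsetP; case/or4P: ij => /eqP->.
  - by exists (inr (inl j)).
  - by exists (inr (inr j)).
  - by exists (inl (inl i)).
  - by exists (inl (inr i)).
apply: leq_trans (subset_leq_card sub) _.
apply: leq_trans (leq_imset_card _ _) _.
by rewrite !card_sum !card_ord; lia.
Qed.

(** This serves the grid with one vertex, for which counting four sides gives 4, too many when
    [k < 4]. *)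
Lemma card_hard_boundary_grid : (#|hard_boundary| <= a.+1 * b.+1)%N.
Proof.
apply: leq_trans (leq_imset_card _ _) _; apply: leq_trans (max_card _) _.
by rewrite card_prod !card_ord.
Qed.

Lemma hard_graphP : (a < p <= k)%N -> (#|hard_boundary| <= k)%N ->
  exists (K : {set T}),
    [/\ treewidth hard_wgraph = p, K \subset vset hard_wgraph, #|K| = k &
       forall G' : wgraph R T, dist_preserving_minor K hard_wgraph G' ->
         (a.+1 * b.+1 <= #|vset G'|)%N /\ (k <= #|vset G'|)%N].
Proof.
move=> /andP[ap pk] le_k.
(* Any vertices off the grid can fill up the terminals; clique vertices are taken first. *)
pose pad := [set (inr (inord i) : T) | i : 'I_(k - #|hard_boundary|)].
pose K := hard_boundary :|: pad.
have KG : K \subset vset hard_wgraph by apply: finset.subsetT.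
have lt_k (i : 'I_(k - #|hard_boundary|)) : (i < k.+1)%N.
  by rewrite ltnS (leq_trans (ltnW (ltn_ord i))) // leq_subr.
have cardK : #|K| = k.
  rewrite cardsU disjoint_setI0 ?cards0 ?subn0.
    rewrite [#|pad|]card_imset ?card_ord ?subnKC // => i j [] /(congr1 val) /=.
    by rewrite !inordK //; apply: val_inj.
  apply/pred0P => u /=; apply/negP.
  by case/andP=> /imsetP[ij _ ->] /imsetP[].
exists K; split=> //; first exact: hard_treewidth.
move=> G' G'P; split; last first.
  have [/terminal_minor_model/(_ KG)[KG' _] _] := G'P.
  by rewrite -cardK subset_leq_card.
apply: (grid_minor_size hard_grid_embedded _ KG _ _ _ _ G'P) => // x.
all: rewrite inE; apply/orP; left.
- by apply/imsetP; exists (x, ord0); rewrite // inE /= ?eqxx ?orbT.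
- by apply/imsetP; exists (x, ord_max); rewrite // inE /= ?eqxx ?orbT.
- by apply/imsetP; exists (ord0, x); rewrite // inE /= ?eqxx ?orbT.
- by apply/imsetP; exists (ord_max, x); rewrite // inE /= ?eqxx ?orbT.
Qed.

End HardGraph.

(** * Choice of the grid and of the constant *)

Theorem theorem8 (R : realType) :
  exists c : R, 0 < c /\
    forall p k : nat, (1 <= p)%N -> (p <= k)%N ->
      (exists (T : finType) (G : wgraph R T) (K : {set T}),
         [/\ treewidth G = p, K \subset vset G, #|K| = k &
             forall G' : wgraph R T, dist_preserving_minor K G G' ->
               c * k%:R * p%:R <= #|vset G'|%:R]) /\
      ((c * p%:R * k%:R)%:E <= fstar R k (TW p))%E.
Proof.
(* 64 is [8 * 8]: for [p, k >= 8] the quotients by 4 are at least [p / 8] and [k / 8]. *)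
exists 64%:R^-1; split=> [|p k p_gt0 pk]; first by rewrite invr_gt0 ltr0n.
have [T [G [K [twG KG cardK G'P]]]] : exists (T : finType) (G : wgraph R T)
    (K : {set T}), [/\ treewidth G = p, K \subset vset G, #|K| = k &
      forall G' : wgraph R T, dist_preserving_minor K G G' ->
        (k * p <= 64 * #|vset G'|)%N].
  (* For small [p] the [k] surviving terminals alone are enough. *)
  have [p_lt8|p_ge8] := ltnP p 8.
    have [||K [? ? ? KP]] := @hard_graphP R 0 0 p k; first by rewrite p_gt0.
      by apply: leq_trans (card_hard_boundary_grid _ _ _) _; lia.
    exists _, (hard_wgraph R 0 0 p k), K; split=> // G' /KP[_ k_le].
    by nia.
  (* With sides [p %/ 4] and [k %/ 4] the boundary has at most [p / 2 + k / 2 <= k] vertices. *)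
  have [||K [? ? ? KP]] := @hard_graphP R (p %/ 4).-1 (k %/ 4).-1 p k.
  - by lia.
  - by apply: leq_trans (card_hard_boundary _ _ _) _; lia.
  exists _, (hard_wgraph R (p %/ 4).-1 (k %/ 4).-1 p k), K.
  split=> // G' /KP[size_le _].
  have p_le : (p <= 8 * (p %/ 4).-1.+1)%N by lia.
  have k_le : (k <= 8 * (k %/ 4).-1.+1)%N by lia.
  by have := leq_mul k_le p_le; nia.
have bound G' N : dist_preserving_minor K G G' -> (#|vset G'| <= N)%N ->
    64%:R^-1 * k%:R * p%:R <= N%:R :> R.
  move=> /G'P kp_le le_N.
  by rewrite -mulrA -natrM ler_pdivrMl ?ltr0n // -natrM ler_nat; lia.
split; first by exists T, G, K; split=> // G' /bound; apply.
apply: le_ereal_inf_tmp => _ [N NP <-].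
have [|G' [G'dp le_N]] := NP T G K _ KG cardK; first by rewrite /TW twG.
by rewrite lee_fin mulrAC; apply: bound G'dp le_N.
Qed.
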